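(* Let $k \geq 3$ be an integer and let $L > 0$ satisfy $\frac{k-1}{kL} \in \mathbb{Z}$. Let $n \geq 2$ and let $\mathcal{I}_n = \{I_1, \ldots, I_n\}$ be drawn using the Scheinerman model with parameter $L$. Color each interval $I \in \mathcal{I}_n$ by the algorithm $$A(I) = \left\lfloor \frac{(k-1)\, c(I)}{L} \right\rfloor \bmod k + 1 \in \{1, \ldots, k\},$$ where $c(I)$ is the center of $I$. Let $m$ be the number of unordered pairs $\{i,j\}$, $i \neq j$, such that $I_i$ and $I_j$ overlap, and let $cut$ be the set of unordered pairs $\{i,j\}$, $i\neq j$, such that $I_i$ and $I_j$ overlap and $A(I_i) \neq A(I_j)$. Then $$\frac{E(|cut|)}{E(m)} = 1-\frac{12}{8 - 3L} \left(\frac{4}{3(k-1)^2}-\frac{1}{(k-1)^3}\right).$$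
   Context: Two intervals $[a,b]$ and $[c,d]$ overlap if and only if $a < c < b < d$ or $c < a < d < b$ (they intersect and neither contains the other). An interval with center $c$ and length $\ell$ is $[c-\ell/2, c+\ell/2]$. The Scheinerman model with parameter $L>0$: the centers of the $n$ intervals are drawn independently and uniformly from $[0,1]$, and the lengths are drawn independently (and independently of the centers) and uniformly from $[0,L]$. The algorithm $A$ splits $[0,1]$ into $\frac{k-1}{L}$ consecutive subintervals of length $\frac{L}{k-1}$ colored cyclically $1,2,\ldots,k,1,2,\ldots$, and gives each interval the color of the subinterval containing its center; it is an online algorithm using only the interval being colored. *)

(* Defs.v *)
From HB Require Import structures.
From mathcomp Require Import all_boot all_order all_algebra archimedean.
From mathcomp Require Import all_classical all_reals all_analysis.

Set Implicit Arguments.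
Unset Strict Implicit.
Unset Printing Implicit Defensive.

Import Order.TTheory GRing.Theory Num.Theory.

Local Open Scope ring_scope.

(* The pair (a, b) stands for the closed interval [a, b]. *)
Definition overlap (R : realType) (I J : R * R) : bool :=
  (I.1 < J.1 < I.2) && (I.2 < J.2) || (J.1 < I.1 < J.2) && (J.2 < I.2).

Definition interval_of (R : realType) (c l : R) : R * R :=
  (c - l / 2, c + l / 2).

Definition interval_center (R : realType) (I : R * R) : R := (I.1 + I.2) / 2.

(* For k > 0 the remainder is nonnegative, so the color lies in {1, ..., k}. *)
Definition interval_color (R : realType) (k : nat) (L : R) (I : R * R) : int :=
  (Num.floor ((k%:R - 1) * interval_center I / L) %% k%:Z)%Z + 1.

Definition overlapping_pairs (R : realType) (n : nat) (I : 'I_n -> R * R) :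
    {set {set 'I_n}} :=
  [set [set i; j]%SET | i in 'I_n, j in 'I_n
                      & (i != j) && overlap (I i) (I j)]%SET.

Definition cut_pairs (R : realType) (n k : nat) (L : R) (I : 'I_n -> R * R) :
    {set {set 'I_n}} :=
  [set [set i; j]%SET | i in 'I_n, j in 'I_n
                      & [&& i != j, overlap (I i) (I j)
                          & interval_color k L (I i) != interval_color k L (I j)]]%SET.

Definition mutually_independent (R : realType) (d : measure_display)
    (T : measurableType d) (P : probability T R) (K : finType)
    (X : K -> {RV P >-> R}) : Prop :=
  forall (J : {set K}) (A : K -> set R),
    (forall i, i \in J -> measurable (A i)) ->
    P (\bigcap_(i in [set` J]) (X i @^-1` A i))%classic =
    (\big[*%E/1]_(i in J) P (X i @^-1` A i)%classic)%E.

Definition uniformly_distributed (R : realType) (d : measure_display)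
    (T : measurableType d) (P : probability T R) (a b : R) (ab : a < b)
    (X : {RV P >-> R}) : Prop :=
  forall A : set R, measurable A -> distribution P X A = uniform_prob ab A.

(* The joint family of the n centers and the n lengths is indexed by the
   disjoint sum 'I_n + 'I_n. *)
Definition scheinerman_model (R : realType) (d : measure_display)
    (T : measurableType d) (P : probability T R) (n : nat) (L : R)
    (L_gt0 : 0 < L) (c l : 'I_n -> {RV P >-> R}) : Prop :=
  [/\ forall i, uniformly_distributed ltr01 (c i),
      forall i, uniformly_distributed L_gt0 (l i)
    & mutually_independent
        (fun s : 'I_n + 'I_n => match s with inl i => c i | inr i => l i end)].

Definition random_intervals (R : realType) (d : measure_display)
    (T : measurableType d) (P : probability T R) (n : nat)
    (c l : 'I_n -> {RV P >-> R}) (w : T) : 'I_n -> R * R :=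
  fun i => interval_of (c i w) (l i w).

(* Main.v *)
(* By linearity, both expectations are the number of pairs times the probability
   for a single pair, whose four coordinates (x, y; s, t) follow the product law.
   Intervals with centers x, y and lengths s, t overlap iff
   |s - t| < 2|x - y| < s + t.  Integrating over s and t at fixed u = |x - y| gives
   the overlap probability (2/L^2) ((L - u)_+^2 - (L - 2u)_+^2), and integrating
   this over centers in a common interval of length e gives an explicit function
   Q(e), with Q(1) = 2L/3 - L^2/4 and Q(e) = 4e^3/(3L) - e^4/L^2 when 2e <= L.
   Overlapping intervals have centers at distance less than L, that is, less than
   k - 1 cells of length L/(k - 1), so they get the same color iff their centers lie
   in the same cell.  The (k - 1)/L cells are disjoint, hence an overlapping pair is
   monochromatic with probability ((k - 1)/L) Q(L/(k - 1)). *)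
Require Import Defs.
From HB Require Import structures.
From mathcomp Require Import all_boot all_order all_algebra archimedean.
From mathcomp Require Import all_classical all_reals all_analysis.
From mathcomp Require Import measurable_realfun zify ring lra.

Set Implicit Arguments.
Unset Strict Implicit.
Unset Printing Implicit Defensive.

Import Order.TTheory GRing.Theory Num.Theory.
Import numFieldNormedType.Exports.

Local Open Scope classical_set_scope.
Local Open Scope ring_scope.

(** * Primitives of powers of the positive part *)

Section calculus.
Context {R : realType}.
Implicit Types (x y z a b : R) (n : nat).

Lemma is_derive_affine (F f : R -> R) a b x :
  (forall z, is_derive z 1 F (f z)) ->
  is_derive x 1 (fun z => F (a + b * z)) (f (a + b * x) * b).
Proof.
move=> dF; have H : is_derive x 1 (fun z => a + b * z) b.
  have -> : (fun z => a + b * z) = cst a + b *: id by [].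
  apply: (is_derive_eq (is_deriveD (is_derive_cst a x 1) (is_deriveZ b (is_derive_id x 1)))).
  by rewrite add0r; exact: mulr1.
exact: (@is_derive1_comp _ F (fun z => a + b * z) x _ _ (dF _) H).
Qed.

Lemma is_derive_continuous (F f : R -> R) :
  (forall z, is_derive z 1 F (f z)) -> continuous F.
Proof.
move=> dF x; apply: differentiable_continuous; apply/derivable1_diffP.
by have [] := dF x.
Qed.

Lemma continuous_affine (f : R -> R) a b :
  continuous f -> continuous (fun z => f (a + b * z)).
Proof.
move=> cf x; apply: continuous_comp; last exact: cf.
by apply: cvgD; [exact: cvg_cst|apply: cvgM; [exact: cvg_cst|exact: cvg_id]].
Qed.

Lemma integral_itv_derive (f F : R -> R) a b : a <= b -> continuous f ->
  (forall x, is_derive x 1 F (f x)) ->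
  (\int[lebesgue_measure]_(x in `[a, b]) (f x)%:E = (F b - F a)%:E)%E.
Proof.
rewrite le_eqVlt => /predU1P[<-|ab] cf dF.
  by rewrite set_itv1 integral_set1 subrr.
have cF := is_derive_continuous dF.
rewrite (continuous_FTC2 ab (F := F)) ?EFinB//.
- exact: continuous_subspaceT.
- split.
  + by move=> x _; have [] := dF x.
  + by apply: cvg_at_right_filter; exact: cF.
  + by apply: cvg_at_left_filter; exact: cF.
- by move=> x _; rewrite derive1E; have [_ ->] := dF x.
Qed.

(** Piecewise polynomials are written as sums of powers of [posp]: from the exponent 2 on these are
    differentiable everywhere, so one global primitive replaces a splitting of the integral. *)
Definition posp x : R := Num.max x 0.

Lemma pospE x : posp x = if 0 <= x then x else 0.
Proof. by rewrite /posp /Order.max ltNge; case: (0 <= x). Qed.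

Lemma posp_ge0 x : 0 <= x -> posp x = x.
Proof. by rewrite pospE => ->. Qed.

Lemma posp_le0 x : x <= 0 -> posp x = 0.
Proof. by rewrite pospE; case: ifPn => //; lra. Qed.

Lemma mulr_posp x : x * posp x = posp x ^+ 2.
Proof. by rewrite pospE; case: ifPn => _; rewrite ?mulr0 ?expr0n // expr2. Qed.

(* The increment of the square of the positive part differs from its linear
   part by at most [h ^+ 2], uniformly in [x]. *)
Lemma is_derive_posp_sqr x : is_derive x 1 (fun z => posp z ^+ 2) (2 * posp x).
Proof.
suff cvgD : h^-1 *: (((fun z => posp z ^+ 2) \o shift x) (h *: (1 : R)) -
    posp x ^+ 2) @[h --> 0^'] --> 2 * posp x.
  by apply: DeriveDef; [apply/cvg_ex; exists (2 * posp x)|apply/cvg_lim].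
apply/cvgrPdist_le => e e0; near=> h.
have h0 : h != 0 by near: h; exact: nbhs_dnbhs_neq.
have he : `|h| <= e.
  by near: h; apply: dnbhs0_le.
apply: le_trans he; rewrite /= scaler1.
rewrite -(ler_pM2r (x := `|h|)) ?normr_gt0//.
have -> : `|2 * posp x - h^-1 * (posp (h + x) ^+ 2 - posp x ^+ 2)| * `|h| =
   `|2 * posp x * h - (posp (h + x) ^+ 2 - posp x ^+ 2)|.
  by rewrite -normrM; congr `|_|; field.
rewrite -normrM ger0_norm -?expr2 ?sqr_ge0// !pospE.
by rewrite ler_norml; case: ifPn => ?; case: ifPn => ?; nra.
Unshelve. all: by end_near. Qed.

(** Induction by the product rule, since z times a positive power of [posp z] raises that power by
    one. *)
Lemma is_derive_posp n x :
  is_derive x 1 (fun z => posp z ^+ n.+2) (n.+2%:R * posp x ^+ n.+1).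
Proof.
elim: n => [|n IH]; first by rewrite expr1; exact: is_derive_posp_sqr.
have -> : (fun z => posp z ^+ n.+3) = id * (fun z => posp z ^+ n.+2).
  by apply/funext => z; rewrite /= fctE [posp z ^+ n.+2]exprS mulrA mulr_posp -exprD.
apply: is_derive_eq.
have xE : x * posp x ^+ n.+1 = posp x ^+ n.+2.
  by rewrite exprS mulrA mulr_posp -exprD.
by rewrite /GRing.scale /= mulr1 mulrCA xE -[n.+3%:R]natr1 [RHS]mulrDl mul1r.
Qed.

Lemma is_derive_posp_affine n a b x :
  is_derive x 1 (fun z => posp (a + b * z) ^+ n.+2)
    (n.+2%:R * posp (a + b * x) ^+ n.+1 * b).
Proof. exact: is_derive_affine (is_derive_posp n). Qed.

Lemma continuous_posp_affine n a b : continuous (fun z => posp (a + b * z) ^+ n).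
Proof.
apply: (@continuous_affine (fun z => posp z ^+ n)) => x.
apply: (@continuous_comp _ _ _ posp (fun y : R => y ^+ n)); last exact: exprn_continuous.
by apply: continuous_max; [exact: cvg_id|exact: cvg_cst].
Qed.

End calculus.

(** * Overlap probability at fixed centers *)

Section overlap_lengths.
Context {R : realType}.
Implicit Types (x y s t u L : R).

(** The first inequality rules out containment (with equal endpoints included), the second says that
    the intervals meet in more than a point. *)
Lemma overlap_interval_of x y s t :
  overlap (interval_of x s) (interval_of y t) =
  (`|s - t| < 2 * `|x - y|) && (2 * `|x - y| < s + t).
Proof.
rewrite /overlap /interval_of /=; apply/idP/idP.
- case/orP => /andP[/andP[h1 h2] h3];
  by case: (ger0P (x - y)) => ?; case: (ger0P (s - t)) => ?; apply/andP; split; lra.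
- case/andP; case: (ger0P (x - y)) => ?; case: (ger0P (s - t)) => ? h1 h2.
  all: apply/orP; first [left; apply/andP; split; [apply/andP; split|]; lra
    | right; apply/andP; split; [apply/andP; split|]; lra].
Qed.

Lemma measurable_overlap d (T : measurableType d) (x y s t : T -> R) :
  measurable_fun setT x -> measurable_fun setT y ->
  measurable_fun setT s -> measurable_fun setT t ->
  measurable [set w | overlap (interval_of (x w) (s w)) (interval_of (y w) (t w))].
Proof.
move=> mx my ms mt; rewrite -[X in measurable X]setTI.
have mn (f : T -> R) : measurable_fun setT f -> measurable_fun setT (fun w => `|f w|).
  by move=> mf; exact: measurableT_comp.
have m2 : measurable_fun setT (fun w => 2 * `|x w - y w|).
  by apply: measurable_funM => //; apply: mn; exact: measurable_funB.
rewrite (_ : [set w | _] = (fun w => (`|s w - t w| < 2 * `|x w - y w|) &&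
    (2 * `|x w - y w| < s w + t w)) @^-1` [set true]); last first.
  by apply/seteqP; split => w /=; rewrite overlap_interval_of.
apply: measurable_and => //; apply: measurable_fun_ltr => //.
- by apply: mn; exact: measurable_funB.
- exact: measurable_funD.
Qed.

Lemma uniform_probE a b (ab : a < b) (A : set R) : measurable A ->
  (uniform_prob ab A = ((b - a)^-1)%:E * lebesgue_measure (A `&` `[a, b]))%E.
Proof.
move=> mA; rewrite -[in LHS](setIT A) -(@integral_indic _ _ _ (uniform_prob ab))//.
rewrite integral_uniform//.
- by rewrite integral_indic.
- exact/measurable_EFinP.
Qed.

Lemma uniform_prob_itv1 (a b : R) (ab : a < b) (e : bool) :
  (uniform_prob ab [set` Interval (BLeft a) (BSide e b)] = 1)%E.
Proof.
rewrite uniform_probE// setIidl; last first.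
  by move=> x; rewrite /= !in_itv/=; case: e => /=; lra.
rewrite lebesgue_measure_itv/= lte_fin ab -EFinB -EFinM mulVf//.
by rewrite subr_eq0 gt_eqF.
Qed.

(** The triangle s, t <= L, s + t > 2u has area 2 (L - u)_+^2. Its two corners |s - t| >= 2u have
    area (L - 2u)_+^2 each, and they contain all its points with a negative coordinate. What is left
    is divided by the area of the square. *)
Definition overlap_given_dist L u : R :=
  2 / L ^+ 2 * (posp (L + -1 * u) ^+ 2 - posp (L + -2 * u) ^+ 2).

(* With [w := 2 * `|x - y|] the section is [ ]`|s - w|, min (s + w) L] ]; truncated
   affine functions of [s] express its length without case distinction. *)
Lemma overlap_section x y L s : 0 <= s <= L ->
  lebesgue_measure ([set t | overlap (interval_of x s) (interval_of y t)] `&` `[0, L]) =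
  (posp (L - 2 * `|x - y| + 1 * s) - 2 * posp (- (2 * `|x - y|) + 1 * s)
    - posp (L - 2 * `|x - y| + -1 * s))%:E.
Proof.
move=> sL; set w := 2 * `|x - y|.
have w0 : 0 <= w by rewrite mulr_ge0.
rewrite (_ : _ `&` _ = [set` Interval (BRight `|s - w|)
    (if s + w <= L then BLeft (s + w) else BRight L)]).
  by case: ifPn => ?; rewrite lebesgue_measure_itv/= lte_fin; case: ifPn;
    rewrite !pospE; case: (ger0P (s - w)) => *; rewrite -?EFinB; congr EFin;
    do 3 case: ifPn => ?; lra.
apply/seteqP; split => t /=; rewrite overlap_interval_of -/w; case: ifPn => ?;
  rewrite !in_itv/=.
- by move=> [/andP[+ ?]]; case: (ger0P (s - w)) => ?; case: (ger0P (s - t)) => *; lra.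
- by move=> [/andP[+ ?]]; case: (ger0P (s - w)) => ?; case: (ger0P (s - t)) => *; lra.
- by case: (ger0P (s - w)) => ?; case: (ger0P (s - t)) => *; split; lra.
- by case: (ger0P (s - w)) => ?; case: (ger0P (s - t)) => *; split; lra.
Qed.

Lemma uniform_lengths_overlap x y L (L0 : 0 < L) :
  ((uniform_prob L0 \x uniform_prob L0)
    [set st | overlap (interval_of x st.1) (interval_of y st.2)] =
   (overlap_given_dist L `|x - y|)%:E)%E.
Proof.
set A := [set _ | _].
have mA : measurable A by exact: measurable_overlap.
rewrite /product_measure1 integral_uniform//; last exact: measurable_fun_xsection.
rewrite subr0; set w := 2 * `|x - y|.
have w0 : 0 <= w by rewrite mulr_ge0.
pose f s := L^-1 * (posp (L - w + 1 * s) - 2 * posp (- w + 1 * s)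
  - posp (L - w + -1 * s)).
transitivity (L^-1%:E * \int[lebesgue_measure]_(s in `[0%R, L])
  (f s)%:E)%E.
  congr mule; apply: eq_integral => s; rewrite inE/= in_itv/= => sL.
  rewrite uniform_probE ?subr0 ?xsectionE; last by rewrite -xsectionE; exact: measurable_xsection.
  by rewrite EFinM -(overlap_section x y sL).
(* A primitive of the section length [f], found term by term. *)
pose F s := L^-1 * (2^-1 * posp (L - w + 1 * s) ^+ 2
  - posp (- w + 1 * s) ^+ 2 + 2^-1 * posp (L - w + -1 * s) ^+ 2).
have cf : continuous f.
  rewrite /f => s; apply: cvgM; first exact: cvg_cst.
  apply: cvgB; first apply: cvgB.
  - exact: (continuous_posp_affine (n := 1)).
  - apply: cvgM; first exact: cvg_cst.
    exact: (continuous_posp_affine (n := 1)).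
  - exact: (continuous_posp_affine (n := 1)).
have dF s : is_derive s 1 F (f s).
  have dE a b := @is_derive_posp_affine _ 0 a b s.
  apply: (is_derive_eq (is_deriveZ L^-1 (is_deriveD (is_deriveB
    (is_deriveZ 2^-1 (dE (L - w) 1)) (dE (- w) 1)) (is_deriveZ 2^-1 (dE (L - w) (-1)))))).
  by rewrite /GRing.scale/= !expr1 /f; field; lra.
rewrite (integral_itv_derive (ltW L0) cf dF) -EFinM; congr EFin.
rewrite /F /overlap_given_dist (_ : -2 * _ = - w); last by rewrite /w mulNr.
rewrite (_ : -1 * `|x - y| = - w / 2); last by rewrite /w; field.
rewrite !pospE ?(mulr1, mul1r, mulr0, addr0).
do 6 (case: ifPn => ?; try by exfalso; lra); try (field; lra).
(* The sign case left over is [0 <= - w], that is, equal centers. *)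
by (have -> : w = 0 by lra); field; lra.
Qed.

End overlap_lengths.

(** * Integration over centers in a common cell *)

Section cell_integral.
Context {R : realType} (L : R).
Implicit Types (x y z a b c : R).

(* [cone], the function [(L - c * |z|)_+ ^ 2] (see [coneE]), is written with powers
   of positive parts of affine functions of [z], whose primitives are explicit. *)
Definition cone c z := posp (L + c * z) ^+ 2 - 4 * L * c * posp (0 + 1 * z) ^+ 1
  - posp (- L + c * z) ^+ 2.
Definition cone_int c z := (3 * c)^-1 * posp (L + c * z) ^+ 3
  - 2 * L * c * posp (0 + 1 * z) ^+ 2 - (3 * c)^-1 * posp (- L + c * z) ^+ 3.
Definition cone_int2 c z := (12 * c ^+ 2)^-1 * posp (L + c * z) ^+ 4
  - 2 / 3 * L * c * posp (0 + 1 * z) ^+ 3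
  - (12 * c ^+ 2)^-1 * posp (- L + c * z) ^+ 4.

(** With z for c z, the three terms of [cone] switch on at -L, 0 and L: first (L + z)^2, then
    subtracting 4 L z turns it into (L - z)^2, and the last term cancels this. *)
Lemma coneE c z : 0 < L -> 0 < c -> posp (L + - c * `|z|) ^+ 2 = cone c z.
Proof.
move=> L0 c0; rewrite /cone expr1 add0r mul1r.
have -> : 4 * L * c * posp z = 4 * L * posp (c * z).
  rewrite !pospE pmulr_rge0//; case: ifPn => _; ring.
have -> : - c * `|z| = - `|c * z| by rewrite normrM (gtr0_norm c0) mulNr.
move: (c * z) => {}z; rewrite !pospE; case: (ger0P z) => z0.
- do ?(case: ifPn => ?; try by exfalso; lra); try ring.
  (* At the breakpoint both the inner and the outer branch are active. *)
  by (have -> : z = L by lra); ring.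
- do ?(case: ifPn => ?; try by exfalso; lra); ring.
Qed.

Lemma continuous_cone c : continuous (cone c).
Proof.
rewrite /cone => z; apply: cvgB; first apply: cvgB.
- exact: (@continuous_posp_affine _ 2).
- by apply: cvgM; [exact: cvg_cst|exact: (@continuous_posp_affine _ 1)].
- exact: (@continuous_posp_affine _ 2).
Qed.

Lemma is_derive_cone_int c z : 0 < c -> is_derive z 1 (cone_int c) (cone c z).
Proof.
move=> c0; apply: (is_derive_eq (is_deriveB (is_deriveB
  (is_deriveZ (3 * c)^-1 (@is_derive_posp_affine _ 1 L c z))
  (is_deriveZ (2 * L * c) (@is_derive_posp_affine _ 0 0 1 z)))
  (is_deriveZ (3 * c)^-1 (@is_derive_posp_affine _ 1 (- L) c z)))).
by rewrite /GRing.scale/= /cone; field; rewrite gt_eqF.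
Qed.

Lemma is_derive_cone_int2 c z : 0 < c -> is_derive z 1 (cone_int2 c) (cone_int c z).
Proof.
move=> c0; apply: (is_derive_eq (is_deriveB (is_deriveB
  (is_deriveZ (12 * c ^+ 2)^-1 (@is_derive_posp_affine _ 2 L c z))
  (is_deriveZ (2 / 3 * L * c) (@is_derive_posp_affine _ 1 0 1 z)))
  (is_deriveZ (12 * c ^+ 2)^-1 (@is_derive_posp_affine _ 2 (- L) c z)))).
by rewrite /GRing.scale/= /cone_int; field; rewrite gt_eqF.
Qed.

(** [overlap_given_dist] in terms of the signed difference z = y - x, so that integrals over y need
    not be split at x. *)
Definition overlap_density z := 2 / L ^+ 2 * (cone 1 z - cone 2 z).
Definition overlap_density_int z := 2 / L ^+ 2 * (cone_int 1 z - cone_int 2 z).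
Definition overlap_density_int2 z := 2 / L ^+ 2 * (cone_int2 1 z - cone_int2 2 z).

Lemma continuous_overlap_density : continuous overlap_density.
Proof.
rewrite /overlap_density => z; apply: cvgM; first exact: cvg_cst.
by apply: cvgB; exact: continuous_cone.
Qed.

Lemma is_derive_overlap_density_int z :
  is_derive z 1 overlap_density_int (overlap_density z).
Proof.
have two_gt0 : 0 < 2 :> R by [].
exact: (is_derive_eq (is_deriveZ (2 / L ^+ 2)
  (is_deriveB (is_derive_cone_int z ltr01) (is_derive_cone_int z two_gt0)))).
Qed.

Lemma is_derive_overlap_density_int2 z :
  is_derive z 1 overlap_density_int2 (overlap_density_int z).
Proof.
have two_gt0 : 0 < 2 :> R by [].
exact: (is_derive_eq (is_deriveZ (2 / L ^+ 2)
  (is_deriveB (is_derive_cone_int2 z ltr01) (is_derive_cone_int2 z two_gt0)))).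
Qed.

Lemma overlap_given_distE x y : 0 < L ->
  overlap_given_dist L `|x - y| = overlap_density (- x + 1 * y).
Proof.
move=> L0; have -> : - x + 1 * y = y - x by ring.
by rewrite /overlap_given_dist /overlap_density distrC -!coneE.
Qed.

Lemma integral_overlap_given_dist x a b : 0 < L -> a <= b ->
  (\int[lebesgue_measure]_(y in `[a, b]) (overlap_given_dist L `|x - y|)%:E =
   (overlap_density_int (b + -1 * x) - overlap_density_int (a + -1 * x))%:E)%E.
Proof.
move=> L0 ab; under eq_integral do rewrite overlap_given_distE//.
have dF y : is_derive y 1 (fun y => overlap_density_int (- x + 1 * y))
    (overlap_density (- x + 1 * y)).
  by have := is_derive_affine (- x) 1 y is_derive_overlap_density_int; rewrite mulr1.
rewrite (integral_itv_derive ab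
  (continuous_affine (a := - x) (b := 1) continuous_overlap_density) dF).
by rewrite !mul1r !mulN1r !(addrC (- x)).
Qed.

Lemma continuous_overlap_given_dist x : 0 < L ->
  continuous (fun y => overlap_given_dist L `|x - y|).
Proof.
move=> L0; rewrite (_ : (fun y => _) = fun y => overlap_density (- x + 1 * y)).
  exact: (continuous_affine (a := - x) (b := 1) continuous_overlap_density).
by apply/funext => y; exact: overlap_given_distE.
Qed.

Lemma continuous_overlap_density_intB a b :
  continuous (fun x => overlap_density_int (b + -1 * x) - overlap_density_int (a + -1 * x)).
Proof.
have c1 := is_derive_continuous is_derive_overlap_density_int.
by move=> x; apply: cvgB; exact: (continuous_affine c1).
Qed.

(* Probability that two intervals overlap and have both centers in a given
   subinterval of [0, 1] of length [e]. *)
Definition overlap_cell_prob e :=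
  overlap_density_int2 e + overlap_density_int2 (- e) - 2 * overlap_density_int2 0.

(** The variable x enters with a minus sign, so a primitive in x is the difference of two shifts of
    [overlap_density_int2]; its increment is a second difference at 0 with step b - a. *)
Lemma integral_integral_overlap a b : a <= b ->
  (\int[lebesgue_measure]_(x in `[a, b])
     (overlap_density_int (b + -1 * x) - overlap_density_int (a + -1 * x))%:E =
   (overlap_cell_prob (b - a))%:E)%E.
Proof.
move=> ab.
have dF x : is_derive x 1
    (fun x => overlap_density_int2 (a + -1 * x) - overlap_density_int2 (b + -1 * x))
    (overlap_density_int (b + -1 * x) - overlap_density_int (a + -1 * x)).
  apply: (is_derive_eq (is_deriveB (is_derive_affine a (-1) x is_derive_overlap_density_int2)
    (is_derive_affine b (-1) x is_derive_overlap_density_int2))).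
  by ring.
rewrite (integral_itv_derive ab (@continuous_overlap_density_intB a b) dF).
by congr EFin; rewrite /overlap_cell_prob !mulN1r !subrr (opprB b a); ring.
Qed.

(** On [-e, e] both cones are still given by their central branch (L - c |z|)^2, which fixes the
    sign of every positive part. *)
Lemma overlap_cell_prob_small e : 0 < L -> 0 <= e -> 2 * e <= L ->
  overlap_cell_prob e = 4 / (3 * L) * e ^+ 3 - e ^+ 4 / L ^+ 2.
Proof.
move=> L0 e0 eL; rewrite /overlap_cell_prob /overlap_density_int2 /cone_int2.
rewrite [posp (L + 1 * e)]posp_ge0; last by lra.
rewrite [posp (0 + 1 * e)]posp_ge0; last by lra.
rewrite [posp (L + 2 * e)]posp_ge0; last by lra.
rewrite [posp (L + 1 * - e)]posp_ge0; last by lra.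
rewrite [posp (L + 2 * - e)]posp_ge0; last by lra.
rewrite [posp (L + 1 * 0)]posp_ge0; last by lra.
rewrite [posp (L + 2 * 0)]posp_ge0; last by lra.
rewrite [posp (- L + 1 * e)]posp_le0; last by lra.
rewrite [posp (- L + 2 * e)]posp_le0; last by lra.
rewrite [posp (0 + 1 * - e)]posp_le0; last by lra.
rewrite [posp (- L + 1 * - e)]posp_le0; last by lra.
rewrite [posp (- L + 2 * - e)]posp_le0; last by lra.
rewrite [posp (0 + 1 * 0)]posp_le0; last by lra.
rewrite [posp (- L + 1 * 0)]posp_le0; last by lra.
rewrite [posp (- L + 2 * 0)]posp_le0; last by lra.
by field; lra.
Qed.

(** Here [-1, 1] contains the supports of both cones: all terms at 1 are active and all terms at -1
    vanish. *)
Lemma overlap_cell_prob1 : 0 < L -> L <= 1 ->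
  overlap_cell_prob 1 = 2 / 3 * L - L ^+ 2 / 4.
Proof.
move=> L0 L1; rewrite /overlap_cell_prob /overlap_density_int2 /cone_int2.
rewrite [posp (L + 1 * 1)]posp_ge0; last by lra.
rewrite [posp (0 + 1 * 1)]posp_ge0; last by lra.
rewrite [posp (- L + 1 * 1)]posp_ge0; last by lra.
rewrite [posp (L + 2 * 1)]posp_ge0; last by lra.
rewrite [posp (- L + 2 * 1)]posp_ge0; last by lra.
rewrite [posp (L + 1 * 0)]posp_ge0; last by lra.
rewrite [posp (L + 2 * 0)]posp_ge0; last by lra.
rewrite [posp (L + 1 * - 1)]posp_le0; last by lra.
rewrite [posp (0 + 1 * - 1)]posp_le0; last by lra.
rewrite [posp (- L + 1 * - 1)]posp_le0; last by lra.
rewrite [posp (L + 2 * - 1)]posp_le0; last by lra.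
rewrite [posp (- L + 2 * - 1)]posp_le0; last by lra.
rewrite [posp (0 + 1 * 0)]posp_le0; last by lra.
rewrite [posp (- L + 1 * 0)]posp_le0; last by lra.
rewrite [posp (- L + 2 * 0)]posp_le0; last by lra.
by field; lra.
Qed.

End cell_integral.

(** * Cell events under the product law *)

Section cell_measure.
Context {R : realType} (L : R) (L0 : 0 < L).
Implicit Types (x y a b : R).

Local Notation U := (uniform_prob (@ltr01 R)).
Local Notation UL := (uniform_prob L0).

(** Cells are half-open so as to partition [0, 1); the endpoint [b] is a null set, which allows the
    closed interval used with primitives. *)
Lemma integral_uniform01_itv (f : R -> \bar R) (h : R -> R) a b :
  measurable_fun setT f -> (forall x, 0 <= f x)%E -> continuous h ->
  0 <= a -> b <= 1 ->
  (forall x, f x = if a <= x < b then (h x)%:E else 0%E) ->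
  (\int[U]_x f x = \int[lebesgue_measure]_(x in `[a, b]) (h x)%:E)%E.
Proof.
move=> mf f0 ch a0 b1 fE; rewrite integral_uniform// subr0 invr1 mul1e.
transitivity (\int[lebesgue_measure]_(x in `[0%R, 1%R])
    (((fun x => (h x)%:E) \_ `[a, b[%classic) x))%E.
  by apply: eq_integral => x _; rewrite fE patchE mem_setE in_itv.
rewrite -integral_mkcondr setIidr; last first.
  by move=> x; rewrite /= !in_itv/= => /andP[ax xb]; apply/andP; split; lra.
apply: integral_itv_bndo_bndc; apply/measurable_EFinP.
by apply: measurable_funTS; exact: continuous_measurable_fun.
Qed.

(** The coordinates are ((x, y), (s, t)): with centers grouped against lengths, the lengths can be
    integrated out first. *)
Definition cell_event a b : set ((R * R) * (R * R)) :=
  [set z | [&& a <= z.1.1 < b, a <= z.1.2 < b &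
    overlap (interval_of z.1.1 z.2.1) (interval_of z.1.2 z.2.2)]].

Lemma measurable_cell_event a b : measurable (cell_event a b).
Proof.
have m1 : measurable_fun setT (fun z : (R * R) * (R * R) => z.1.1).
  exact: (measurableT_comp measurable_fst measurable_fst).
have m2 : measurable_fun setT (fun z : (R * R) * (R * R) => z.1.2).
  exact: (measurableT_comp measurable_snd measurable_fst).
have m3 : measurable_fun setT (fun z : (R * R) * (R * R) => z.2.1).
  exact: (measurableT_comp measurable_fst measurable_snd).
have m4 : measurable_fun setT (fun z : (R * R) * (R * R) => z.2.2).
  exact: (measurableT_comp measurable_snd measurable_snd).
have -> : cell_event a b = (fun z => z.1.1) @^-1` `[a, b[ `&`
    ((fun z => z.1.2) @^-1` `[a, b[ `&` [set z : (R * R) * (R * R) |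
      overlap (interval_of z.1.1 z.2.1) (interval_of z.1.2 z.2.2)]).
  by apply/seteqP; split => z /=; rewrite !in_itv/=; [case/and3P|case=> ? [? ?]; apply/and3P].
apply: measurableI.
  by rewrite -[X in measurable X]setTI; apply: m1 => //; exact: measurable_itv.
apply: measurableI; last exact: measurable_overlap.
by rewrite -[X in measurable X]setTI; apply: m2 => //; exact: measurable_itv.
Qed.

(** The section over fixed centers in the cell has measure [overlap_given_dist]; Tonelli then
    integrates over the second center and finally over the first. *)
Lemma measure_cell_event a b : 0 <= a -> a <= b -> b <= 1 ->
  (((U \x U) \x (UL \x UL)) (cell_event a b) = (overlap_cell_prob L (b - a))%:E)%E.
Proof.
move=> a0 ab b1; rewrite {1}/product_measure1.
set f := _ \o _.
have mf : measurable_fun setT f.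
  exact: (measurable_fun_xsection
    (product_subprobability (UL : subprobability _ _, UL : subprobability _ _))
    (measurable_cell_event a b)).
have f0 z : (0 <= f z)%E by exact: measure_ge0.
have fE x y : f (x, y) = if a <= x < b then if a <= y < b then
    (overlap_given_dist L `|x - y|)%:E else 0%E else 0%E.
  rewrite /f /= -(uniform_lengths_overlap x y L0).
  have sE : xsection (cell_event a b) (x, y) = if (a <= x < b) && (a <= y < b) then
      [set st | overlap (interval_of x st.1) (interval_of y st.2)] else set0.
    rewrite xsectionE; case: ifPn => xy; apply/seteqP; split => st //=.
    - by case/and3P.
    - by move=> st_ov; rewrite /cell_event /= andbA xy.
    - by case/and3P => xab yab _; move: xy; rewrite xab yab.
  by rewrite sE; case: (a <= x < b) => /=; case: (a <= y < b) => //=;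
    rewrite measure0.
clearbody f; rewrite (fubini_tonelli1 f)// /fubini_F.
have FE x : (\int[U]_y f (x, y) = if (a <= x < b)%R then
    (overlap_density_int L (b + -1 * x) - overlap_density_int L (a + -1 * x))%:E else 0)%E.
  case: ifPn => xab; last by rewrite integral0_eq// => y _; rewrite fE (negbTE xab).
  rewrite -integral_overlap_given_dist//.
  apply: (@integral_uniform01_itv (fun y => f (x, y))
    (fun y => overlap_given_dist L `|x - y|) a b) => //.
  - exact: measurableT_comp mf (measurable_pair1 x).
  - exact: continuous_overlap_given_dist.
  - by move=> y; rewrite fE xab.
rewrite -integral_integral_overlap//.
apply: integral_uniform01_itv => //.
- exact: measurable_fun_fubini_tonelli_F.
- by move=> x; exact: integral_ge0.
- exact: continuous_overlap_density_intB.
Qed.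

End cell_measure.

(** * Joint laws determined by rectangles *)

Section joint_laws.
Local Open Scope ereal_scope.
Context d (T : measurableType d) (R : realType) (P : probability T R).

(** Rectangles are stable under intersection and generate the product sigma-algebra. *)
Lemma measure_rect_unique d1 d2 (T1 : measurableType d1) (T2 : measurableType d2)
    (m m' : {measure set (T1 * T2) -> \bar R}) :
  m setT < +oo ->
  (forall A B, measurable A -> measurable B -> m (A `*` B) = m' (A `*` B)) ->
  forall X, measurable X -> m X = m' X.
Proof.
move=> moo mm' X mX.
apply: (measure_unique [set A `*` B | A in measurable & B in measurable]
  (fun _ => setT)) => //.
- exact: measurable_prod_measurableType.
- move=> _ _ [A mA [B mB <-]] [A' mA' [B' mB' <-]]; rewrite -setXI.
  exists (A `&` A'); first exact: measurableI.
  by exists (B `&` B') => //; exact: measurableI.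
- by move=> _; exists setT => //; exists setT => //; rewrite setXTT.
- exact: bigcup_const.
- by move=> _ [A mA [B mB <-]]; exact: mm'.
Qed.

(** As functions of [D] both sides are finite measures: the law of the pair under [P] restricted to
    [E], and its law under [P] scaled by [P E]. *)
Lemma indep_event_pair d1 d2 (T1 : measurableType d1) (T2 : measurableType d2)
    (E : set T) (X : T -> T1) (Y : T -> T2) :
  measurable E -> measurable_fun setT X -> measurable_fun setT Y ->
  (forall A B, measurable A -> measurable B ->
    P (E `&` (X @^-1` A `&` Y @^-1` B)) = P E * P (X @^-1` A `&` Y @^-1` B)) ->
  forall D, measurable D ->
    P (E `&` (fun w => (X w, Y w)) @^-1` D) = P E * P ((fun w => (X w, Y w)) @^-1` D).
Proof.
move=> mE mX mY H D mD.
have mXY : measurable_fun setT (fun w => (X w, Y w)) by exact: measurable_fun_pair.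
have PE : P E = (fine (P E))%:E by rewrite fineK// fin_num_measure.
have e0 : (0 <= fine (P E))%R by rewrite fine_ge0.
pose XY w := (X w, Y w).
pose m1 := pushforward (mrestr P mE) XY : {measure set _ -> \bar R}.
pose m2 := mscale (NngNum e0) (pushforward P XY) : {measure set _ -> \bar R}.
have m1E C : m1 mXY C = P (XY @^-1` C `&` E) by [].
have m2E C : m2 mXY C = P E * P (XY @^-1` C) by rewrite PE.
rewrite -m2E setIC -m1E; apply: measure_rect_unique => //.
- by rewrite m1E preimage_setT setTI -ge0_fin_numE// fin_num_measure.
- by move=> A B mA mB; rewrite m1E m2E setIC; exact: H.
Qed.

Lemma joint_law d1 d2 (T1 : measurableType d1) (T2 : measurableType d2)
    (mu1 : {sigma_finite_measure set T1 -> \bar R})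
    (mu2 : {sigma_finite_measure set T2 -> \bar R}) (X : T -> T1) (Y : T -> T2) :
  measurable_fun setT X -> measurable_fun setT Y ->
  (forall A B, measurable A -> measurable B ->
    P (X @^-1` A `&` Y @^-1` B) = mu1 A * mu2 B) ->
  forall D, measurable D -> P ((fun w => (X w, Y w)) @^-1` D) = (mu1 \x mu2) D.
Proof.
move=> mX mY H D mD.
have mXY : measurable_fun setT (fun w => (X w, Y w)) by exact: measurable_fun_pair.
pose m := pushforward P (fun w => (X w, Y w)) : {measure set _ -> \bar R}.
by rewrite (@product_measure_unique _ _ _ _ _ mu1 mu2 (m mXY)).
Qed.

End joint_laws.

(** * Joint law of two random intervals *)

Section scheinerman_joint_law.
Local Open Scope ereal_scope.
Context d (T : measurableType d) (R : realType) (P : probability T R).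
Context (n : nat) (L : R) (L0 : (0 < L)%R) (c l : 'I_n -> {RV P >-> R}).
Hypothesis model : scheinerman_model L0 c l.

Local Notation U := (uniform_prob (@ltr01 R)).
Local Notation UL := (uniform_prob L0).

Lemma scheinerman_rect (i j : 'I_n) (A A' B B' : set R) : i != j ->
  measurable A -> measurable A' -> measurable B -> measurable B' ->
  P ((c i @^-1` A `&` c j @^-1` A') `&` (l i @^-1` B `&` l j @^-1` B')) =
  (U A * U A') * (UL B * UL B').
Proof.
move=> ij mA mA' mB mB'; have [Uc Ul indep] := model.
(* Independence is applied to the four indices of the centers and lengths of [i] and [j], which are
   distinct because [i != j]. *)
pose F (s : 'I_n + 'I_n) := match s with
  | inl u => if u == i then A else A' | inr u => if u == i then B else B' end.
have ji : (j == i) = false by rewrite eq_sym; exact: negbTE.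
have mF s : s \in [set inl i; inl j; inr i; inr j]%SET -> measurable (F s).
  by case: s => u _ /=; case: ifP.
have := indep _ _ mF; rewrite -!finset.setUA !big_setU1 ?big_set1 ?inE//=.
  rewrite eqxx ji -(Uc i A)// -(Uc j A')// -(Ul i B)// -(Ul j B')//.
  rewrite /distribution /pushforward muleA => <-; congr (P _).
  apply/seteqP; split => w /=.
  - move=> [[wA wA'] [wB wB']] s; rewrite /F /= !inE.
    by case: s => u /=; rewrite ?orbF /=; case: ifP => [/eqP ->//|ui];
      rewrite ?(inj_eq inl_inj) ?(inj_eq inr_inj) ui /= => /eqP ->.
  - move=> H; split; split.
    + by have := H (inl i); rewrite /F /= eqxx !inE eqxx; exact.
    + by have := H (inl j); rewrite /F /= ji !inE eqxx ?orbT; exact.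
    + by have := H (inr i); rewrite /F /= eqxx !inE eqxx ?orbT; exact.
    + by have := H (inr j); rewrite /F /= ji !inE eqxx ?orbT; exact.
apply/norP; split => //; by apply: contra ij => /eqP[->].
Qed.

(** Independence passes from boxes to pairs one side at a time: [step1] allows any event on the
    lengths, [step2] then any event on the centers. *)
Lemma scheinerman_joint_law (i j : 'I_n) (E : set ((R * R) * (R * R))) :
  i != j -> measurable E ->
  P [set w | E ((c i w, c j w), (l i w, l j w))] = ((U \x U) \x (UL \x UL)) E.
Proof.
move=> ij mE.
have rect := scheinerman_rect ij.
have rectc A A' : measurable A -> measurable A' ->
    P (c i @^-1` A `&` c j @^-1` A') = U A * U A'.
  move=> mA mA'; have := rect A A' setT setT mA mA' measurableT measurableT.
  by rewrite !preimage_setT !setIT !probability_setT !mule1.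
have rectl B B' : measurable B -> measurable B' ->
    P (l i @^-1` B `&` l j @^-1` B') = UL B * UL B'.
  move=> mB mB'; have := rect setT setT B B' measurableT measurableT mB mB'.
  by rewrite !preimage_setT !setTI !probability_setT !mul1e.
have mpre (X : {RV P >-> R}) (A : set R) : measurable A -> measurable (X @^-1` A).
  by move=> mA; rewrite -[X in measurable X]setTI; exact: measurable_funPT.
have step1 A A' D : measurable A -> measurable A' -> measurable D ->
    P ((c i @^-1` A `&` c j @^-1` A') `&` (fun w => (l i w, l j w)) @^-1` D) =
    P (c i @^-1` A `&` c j @^-1` A') * P ((fun w => (l i w, l j w)) @^-1` D).
  move=> mA mA' mD; apply: indep_event_pair => //.
  - by apply: measurableI; exact: mpre.
  - by move=> B B' mB mB'; rewrite rect// rectc// rectl.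
have ml : measurable_fun setT (fun w => (l i w, l j w)) by exact: measurable_fun_pair.
have mc : measurable_fun setT (fun w => (c i w, c j w)) by exact: measurable_fun_pair.
have step2 C D : measurable C -> measurable D ->
    P ((fun w => (c i w, c j w)) @^-1` C `&` (fun w => (l i w, l j w)) @^-1` D) =
    P ((fun w => (c i w, c j w)) @^-1` C) * P ((fun w => (l i w, l j w)) @^-1` D).
  move=> mC mD; rewrite setIC muleC; apply: indep_event_pair => //.
  - by rewrite -[X in measurable X]setTI; exact: ml.
  - by move=> A A' mA mA'; rewrite setIC muleC; exact: step1.
apply: (joint_law
  (mu1 := product_subprobability (U : subprobability _ _, U : subprobability _ _))
  (mu2 := product_subprobability (UL : subprobability _ _, UL : subprobability _ _))
  mc ml _ mE).
move=> C D mC mD; rewrite step2//; congr (_ * _).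
- exact: (joint_law (mu1 := U) (mu2 := U)
    (measurable_funPT (c i)) (measurable_funPT (c j)) rectc).
- exact: (joint_law (mu1 := UL) (mu2 := UL)
    (measurable_funPT (l i)) (measurable_funPT (l j)) rectl).
Qed.

End scheinerman_joint_law.

(** * Same color and same cell *)

Section same_color.
Context {R : realType} (k M : nat) (L : R).
Hypothesis k_gt2 : (2 < k)%N.
Hypothesis M_gt0 : (0 < M)%N.
Hypothesis cellsE : (k%:R - 1) / L = M%:R.
Implicit Types x y s t : R.

Lemma interval_colorE x s :
  interval_color k L (interval_of x s) = (Num.floor (M%:R * x) %% k%:Z)%Z + 1.
Proof.
rewrite /interval_color /interval_center /interval_of /=.
by rewrite mulrAC cellsE; congr ((Num.floor (_ * _) %% _)%Z + _); field.
Qed.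

(** The floors differ by less than |a - b| + 1 < k, and 0 is the only multiple of [k] that small. *)
Lemma eq_floor_of_eqmod (a b : R) : `|a - b| < k%:R - 1 ->
  (Num.floor a = Num.floor b %[mod k%:Z])%Z -> Num.floor a = Num.floor b.
Proof.
move=> ab /eqP; rewrite eqz_mod_dvd => /dvdzP[q qE].
have /andP[a1 a2] := floor_itv a; have /andP[b1 b2] := floor_itv b.
rewrite intrD in a2; rewrite intrD in b2.
have : `|q * k%:Z| < k%:Z.
  rewrite -qE -(ltr_int R) intr_norm intrB.
  move: ab; rewrite !ltr_norml => /andP[h1 h2]; apply/andP; split; lra.
rewrite normrM [`|k%:Z|]ger0_norm//.
rewrite gtr_pMl ?ltz_nat//; last by apply: leq_trans k_gt2.
move=> q1.
have q0 : q = 0 by lia.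
by move: qE; rewrite q0 mul0r => /eqP; rewrite subr_eq0 => /eqP.
Qed.

Lemma overlap_same_color x y s t : 0 < L -> s <= L -> t <= L ->
  0 <= x < 1 -> 0 <= y < 1 ->
  overlap (interval_of x s) (interval_of y t) ->
  (interval_color k L (interval_of x s) == interval_color k L (interval_of y t)) <->
  exists m : 'I_M, m%:R / M%:R <= x < (m%:R + 1) / M%:R /\
                   m%:R / M%:R <= y < (m%:R + 1) / M%:R.
Proof.
move=> L0 sL tL x01 y01 ov; rewrite !interval_colorE.
have MR : 0 < M%:R :> R by rewrite ltr0n.
have cellP (m : nat) (z : R) : (m%:R / M%:R <= z < (m%:R + 1) / M%:R) <->
    Num.floor (M%:R * z) = m%:Z.
  rewrite ler_pdivrMr// ltr_pdivlMr// (mulrC z); split.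
    by move=> mz; apply: floor_def; rewrite intrD.
  by move=> fz; have := floor_itv (M%:R * z); rewrite fz intrD.
split.
- move=> /eqP/addIr colE.
  have fE : Num.floor (M%:R * x) = Num.floor (M%:R * y).
    apply: eq_floor_of_eqmod colE.
    (* Overlap gives 2 |x - y| < s + t <= 2 L; scaling by M = (k - 1) / L yields the bound k - 1. *)
    rewrite -mulrBr normrM gtr0_norm// -cellsE mulrAC ltr_pdivrMr// ltr_pM2l.
      move: ov; rewrite overlap_interval_of => /andP[_ h]; lra.
    by rewrite subr_gt0 ltr1n; apply: leq_trans k_gt2.
  have f0 : 0 <= Num.floor (M%:R * x).
    by rewrite floor_ge0 mulr_ge0//; lra.
  (* The bound x < 1 must be strict: a center at 1 would have cell index [M]. *)
  have fM : (`|Num.floor (M%:R * x)| < M)%N.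
    rewrite -ltz_nat gez0_abs// -(ltr_int R).
    have /andP[h _] := floor_itv (M%:R * x); apply: le_lt_trans h _.
    by rewrite -[ltRHS]mulr1 ltr_pM2l//; lra.
  exists (Ordinal fM); rewrite !cellP /= -fE.
  by rewrite gez0_abs.
- by move=> [m [/cellP -> /cellP ->]].
Qed.

End same_color.

(** * Measurability of color events *)

Section floor_events.
Context d (T : measurableType d) (R : realType).

Lemma measurable_floor_eq (X : T -> R) (a : int) : measurable_fun setT X ->
  measurable [set w | Num.floor (X w) = a].
Proof.
move=> mX.
have -> : [set w | Num.floor (X w) = a] = X @^-1` `[a%:~R, (a + 1)%:~R[.
  apply/seteqP; split => w /=; rewrite in_itv/=.
    by move=> <-; exact: floor_itv.
  exact: floor_def.
by rewrite -[X in measurable X]setTI; apply: mX => //; exact: measurable_itv.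
Qed.

(** The event is a countable union, over pairs of integers congruent modulo [k], of events fixing
    both floors. *)
Lemma measurable_same_color k (L : R) (x s y t : T -> R) :
  measurable_fun setT x -> measurable_fun setT y ->
  measurable [set w | interval_color k L (interval_of (x w) (s w)) =
                      interval_color k L (interval_of (y w) (t w))].
Proof.
move=> mx my; pose g (z : R) := (k%:R - 1) * z / L.
have colE z u : interval_color k L (interval_of z u) = (Num.floor (g z) %% k%:Z)%Z + 1.
  rewrite /interval_color /interval_center /interval_of /= /g.
  by congr ((Num.floor (_ * _ / _) %% _)%Z + _); field.
have mg (z : T -> R) : measurable_fun setT z -> measurable_fun setT (g \o z).
  by move=> mz; apply: measurable_funM => //; exact: measurable_funM.
pose F (ab : int * int) := if ((ab.1 %% k%:Z)%Z == (ab.2 %% k%:Z)%Z) then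
  [set w | Num.floor (g (x w)) = ab.1] `&` [set w | Num.floor (g (y w)) = ab.2]
  else set0.
have -> : [set w | interval_color k L (interval_of (x w) (s w)) =
                   interval_color k L (interval_of (y w) (t w))] =
    \bigcup_ab F ab.
  apply/seteqP; split => w /=; rewrite !colE.
    move=> /addIr ab; exists (Num.floor (g (x w)), Num.floor (g (y w))) => //.
    by rewrite /F /= ab eqxx.
  by move=> [[a b] _]; rewrite /F /=; case: ifPn => // /eqP ab [-> ->]; rewrite ab.
apply: countable_bigcupT_measurable => // ab; rewrite /F; case: ifPn => _ //.
by apply: measurableI; apply: measurable_floor_eq; exact: mg.
Qed.

End floor_events.

(** * Counting unordered pairs *)

Section pair_count.
Context {n : nat}.

(** Each two-element set is represented exactly once by its increasing ordering. *)
Lemma card_sym_pairs (r : rel 'I_n) : symmetric r ->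
  #|[set [set i; j]%SET | i in 'I_n, j in 'I_n & (i != j) && r i j]%SET| =
  (\sum_(u : 'I_n * 'I_n | (u.1 < u.2)%N) r u.1 u.2)%N.
Proof.
move=> rC; pose pairs := [set u : 'I_n * 'I_n | (u.1 < u.2)%N && r u.1 u.2]%SET.
transitivity #|[set [set u.1; u.2]%SET | u in pairs]%SET|.
  apply: eq_card => X; apply/imset2P/imsetP.
  - move=> [i j _]; rewrite inE /= => /andP[ij rij] ->.
    have [lij|lji|eij] := ltngtP i j.
    + by exists (i, j); rewrite ?inE /= ?lij.
    + by exists (j, i); rewrite ?inE /= ?lji 1?rC// finset.setUC.
    + by move: ij; rewrite (ord_inj eij) eqxx.
  - move=> [[i j]]; rewrite inE /= => /andP[lij rij] ->.
    by exists i j; rewrite ?inE // rij andbT -val_eqE ltn_eqF.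
rewrite card_in_imset.
  rewrite -sum1_card (eq_bigl (fun u : 'I_n * 'I_n => (u.1 < u.2)%N && r u.1 u.2)).
    by rewrite big_mkcondr; apply: eq_bigr => u _; case: (r _ _).
  by move=> u; rewrite inE.
move=> [i j] [i' j']; rewrite !inE /= => /andP[lij _] /andP[lij' _] /setP eqs.
have := eqs i; have := eqs j; have := eqs i'; have := eqs j'.
rewrite !inE !eqxx ?orbT /= -!val_eqE /=.
move=> h1 h2 h3 h4; congr pair; apply: val_inj => /=; lia.
Qed.

End pair_count.

(** * Almost sure events and expected counts *)

Section probability_facts.
Local Open Scope ereal_scope.
Context d (T : measurableType d) (R : realType) (P : probability T R).
Implicit Types A B F : set T.

Lemma probability1I A F : measurable A -> measurable F -> P F = 1 ->
  P (A `&` F) = P A.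
Proof.
move=> mA mF PF; have PFC : P (~` F) = 0 by rewrite probability_setC// PF subee.
rewrite [RHS](measureDI P mA mF) [X in X + _](_ : _ = 0) ?add0e//.
by apply: subset_measure0 PFC; [exact: measurableD|exact: measurableC|move=> w []].
Qed.

(** Serves to compare events that agree only when centers and lengths lie in their nominal
    ranges. *)
Lemma eq_probability1 A B F : measurable A -> measurable B -> measurable F ->
  P F = 1 -> (forall w, F w -> A w <-> B w) -> P A = P B.
Proof.
move=> mA mB mF PF AB; rewrite -(probability1I mA mF PF) -(probability1I mB mF PF).
by congr (P _); apply/seteqP; split => w [h Fw]; split => //; apply/(AB w Fw).
Qed.

(** Linearity: the count is a sum of indicators over increasing pairs, each with integral [p]. *)
Lemma expectation_card_pairs n (r : T -> rel 'I_n) (p : R) :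
  (forall w, symmetric (r w)) ->
  (forall i j, measurable [set w | r w i j]) ->
  (forall i j, i != j -> P [set w | r w i j] = p%:E) ->
  'E_P[fun w => #|[set [set i; j]%SET | i in 'I_n, j in 'I_n
                  & (i != j) && r w i j]%SET|%:R] =
  (#|[set u : 'I_n * 'I_n | (u.1 < u.2)%N]%SET|%:R * p)%:E.
Proof.
move=> rC mr Pr; rewrite unlock.
transitivity (\int[P]_w \sum_(u <- [seq u : 'I_n * 'I_n <- index_enum _ | (u.1 < u.2)%N])
    (\1_[set w | r w u.1 u.2] w)%:E).
  apply: eq_integral => w _; rewrite big_filter card_sym_pairs// sumEFin natr_sum.
  congr EFin; apply: eq_bigr => u _; rewrite indicE.
  by rewrite mem_setE.
rewrite ge0_integral_sum//; last first.
  by move=> u; exact/measurable_EFinP.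
rewrite big_filter (eq_bigr (fun _ => p%:E)).
  by rewrite sumEFin sumr_const mulr_natl cardsE.
move=> u lu; rewrite integral_indic// setIT; apply: Pr.
by rewrite -val_eqE ltn_eqF.
Qed.

End probability_facts.

(** * Probabilities for a single pair *)

Section scheinerman_probabilities.
Local Open Scope ereal_scope.
Context d (T : measurableType d) (R : realType) (P : probability T R).
Context (n : nat) (L : R) (L0 : (0 < L)%R) (c l : 'I_n -> {RV P >-> R}).
Hypothesis model : scheinerman_model L0 c l.
Implicit Types i j : 'I_n.

Let I := random_intervals c l.

(** The center 1 is excluded, so that every center falls in one of the half-open cells. *)
Definition range_event i j : set T :=
  (c i @^-1` `[0%R, 1%R[ `&` c j @^-1` `[0%R, 1%R[) `&`
  (l i @^-1` `[0%R, L] `&` l j @^-1` `[0%R, L]).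

Let mpre (X : {RV P >-> R}) (A : set R) : measurable A -> measurable (X @^-1` A).
Proof. by move=> mA; rewrite -[X in measurable X]setTI; exact: measurable_funPT. Qed.

Lemma measurable_range_event i j : measurable (range_event i j).
Proof.
by apply: measurableI; apply: measurableI; apply: mpre; exact: measurable_itv.
Qed.

Lemma probability_range_event i j : i != j -> P (range_event i j) = 1.
Proof.
by move=> ij; rewrite (scheinerman_rect model ij)// !uniform_prob_itv1 !mule1.
Qed.

Definition same_cell i j (a b : R) : set T :=
  [set w | cell_event a b ((c i w, c j w), (l i w, l j w))].

Lemma measurable_same_cell i j a b : measurable (same_cell i j a b).
Proof.
rewrite -[X in measurable X]setTI.
have mh : measurable_fun setT (fun w => ((c i w, c j w), (l i w, l j w))).
  by apply: measurable_fun_pair; exact: measurable_fun_pair.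
by apply: mh => //; exact: measurable_cell_event.
Qed.

Lemma probability_same_cell i j (a b : R) : i != j ->
  (0 <= a)%R -> (a <= b)%R -> (b <= 1)%R ->
  P (same_cell i j a b) = (overlap_cell_prob L (b - a))%:E.
Proof.
move=> ij a0 ab b1; rewrite (scheinerman_joint_law model ij).
  exact: measure_cell_event.
exact: measurable_cell_event.
Qed.

Definition overlap_event i j : set T := [set w | overlap (I w i) (I w j)].

Lemma measurable_overlap_event i j : measurable (overlap_event i j).
Proof. exact: measurable_overlap. Qed.

(** On [range_event] both centers lie in [0, 1), taken as a single cell. *)
Lemma probability_overlap i j : i != j ->
  P (overlap_event i j) = (overlap_cell_prob L 1)%:E.
Proof.
move=> ij; rewrite -[X in overlap_cell_prob L X]subr0.
rewrite -(probability_same_cell ij)//.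
apply: (eq_probability1 (measurable_overlap_event i j) (measurable_same_cell i j _ _)
  (measurable_range_event i j) (probability_range_event ij)) => w [[]] /=.
by rewrite !in_itv/= /same_cell /cell_event /= => -> -> _.
Qed.

Section colors.
Context (k M : nat).
Hypothesis k_gt2 : (2 < k)%N.
Hypothesis M_gt0 : (0 < M)%N.
Hypothesis cellsE : ((k%:R - 1) / L = M%:R)%R.

Definition same_color_event i j : set T :=
  [set w | interval_color k L (I w i) = interval_color k L (I w j)].

Lemma measurable_same_color_event i j : measurable (same_color_event i j).
Proof. exact: measurable_same_color. Qed.

Lemma probability_overlap_same_color i j : i != j ->
  P (overlap_event i j `&` same_color_event i j) =
  (M%:R * overlap_cell_prob L M%:R^-1)%:E.
Proof.
move=> ij; have MR : (0 < M%:R :> R)%R by rewrite ltr0n.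
(* Almost surely the event is the disjoint union of the [Q m], all of the same probability. *)
pose Q (m : 'I_M) := same_cell i j (m%:R / M%:R) ((m%:R + 1) / M%:R).
have -> : P (overlap_event i j `&` same_color_event i j) =
    P (\big[setU/set0]_(m < M) Q m).
  apply: (eq_probability1 _ _ (measurable_range_event i j) (probability_range_event ij)).
  - by apply: measurableI; [exact: measurable_overlap_event|exact: measurable_same_color_event].
  - by apply: bigsetU_measurable => m _; exact: measurable_same_cell.
  move=> w [[/=]]; rewrite !in_itv/= => ci cj [] /andP[_ li] /andP[_ lj].
  rewrite -bigcup_seq /= /overlap_event /same_color_event /=.
  split.
  - move=> [ov /eqP].
    move/(overlap_same_color k_gt2 M_gt0 cellsE L0 li lj ci cj ov) => [m [mi mj]].
    exists m; first exact: mem_index_enum.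
    by rewrite /Q /same_cell /cell_event /= mi mj.
  - move=> [m _]; rewrite /Q /same_cell /cell_event /= => /and3P[mi mj ov]; split => //.
    apply/eqP/(overlap_same_color k_gt2 M_gt0 cellsE L0 li lj ci cj ov).
    by exists m.
rewrite measure_bigsetU_ord.
- have Qm m : P (Q m) = (overlap_cell_prob L M%:R^-1)%:E.
    rewrite probability_same_cell//.
    + by congr (overlap_cell_prob _ _)%:E; field; rewrite gt_eqF.
    + by rewrite ler_pM2r ?invr_gt0// lerDl.
    + by rewrite ler_pdivrMr// mul1r natr1 ler_nat.
  rewrite (eq_bigr (fun _ => (overlap_cell_prob L M%:R^-1)%:E)); last first.
    by move=> m _; exact: Qm.
  by rewrite sumEFin sumr_const card_ord mulr_natl.
- by move=> m; exact: measurable_same_cell.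
- apply/trivIsetP => m m' _ _ mm'; rewrite -subset0 => w [].
  rewrite /Q /same_cell /cell_event /= => /and3P[+ _ _] /and3P[+ _ _].
  rewrite !ler_pdivrMr// !ltr_pdivlMr// !natr1 => /andP[a1 a2] /andP[b1 b2].
  (* A center in both cells forces m < m' + 1 and m' < m + 1. *)
  have := le_lt_trans a1 b2; have := le_lt_trans b1 a2; rewrite !ltr_nat.
  by move=> h1 h2; move/eqP: mm'; apply; apply: val_inj => /=; lia.
Qed.

Lemma probability_overlap_cut i j : i != j ->
  P (overlap_event i j `\` same_color_event i j) =
  (overlap_cell_prob L 1 - M%:R * overlap_cell_prob L M%:R^-1)%:E.
Proof.
move=> ij; rewrite measureD.
- rewrite EFinB; congr (_ - _).
    exact: probability_overlap.
  exact: probability_overlap_same_color.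
- exact: measurable_overlap_event.
- exact: measurable_same_color_event.
- exact: le_lt_trans (probability_le1 P (measurable_overlap_event i j)) (ltry 1).
Qed.

End colors.

End scheinerman_probabilities.

(** * The ratio of expectations *)

Lemma overlapC (R : realType) (I J : R * R) : overlap I J = overlap J I.
Proof. by rewrite /overlap orbC. Qed.

Theorem theorem1 (R : realType) (d : measure_display) (T : measurableType d)
    (P : probability T R) (k n : nat) (L : R) (L_gt0 : 0 < L)
    (c l : 'I_n -> {RV P >-> R}) :
  (3 <= k)%N -> (2 <= n)%N ->
  (k%:R - 1) / (k%:R * L) \is a Num.int ->
  scheinerman_model L_gt0 c l ->
  ('E_P[fun w => #|cut_pairs k L (random_intervals c l w)|%:R] /
   'E_P[fun w => #|overlapping_pairs (random_intervals c l w)|%:R])%E =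
  (1 - 12 / (8 - 3 * L) *
       (4 / (3 * (k%:R - 1) ^+ 2) - 1 / (k%:R - 1) ^+ 3))%:E.
Proof.
move=> k3 n2 /intrP[z zE] model.
have kR : 3 <= k%:R :> R by rewrite ler_nat.
have z_gt0 : (0 < z)%R.
  by rewrite -(ltr0z R) -zE divr_gt0 ?mulr_gt0//; lra.
(* The (k - 1) / L = k N cells form N >= 1 full color cycles; hence L <= (k - 1) / k < 1. *)
case: z z_gt0 zE => // N N_gt0; rewrite -pmulrn => NE.
have NR : 0 < N%:R :> R by rewrite ltr0n.
have cellsE : (k%:R - 1) / L = (k * N)%:R.
  by rewrite natrM -NE; field; lra.
have kN_gt0 : (0 < k * N)%N by rewrite muln_gt0 (ltn_trans _ k3).
have LE : L = (k%:R - 1) / (k * N)%:R by rewrite -cellsE; field; lra.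
have kNR : k%:R <= (k * N)%:R :> R by rewrite ler_nat leq_pmulr.
have L1 : L < 1 by rewrite LE ltr_pdivrMr; lra.
set M := (k * N)%N in cellsE kN_gt0 LE kNR.
set I := random_intervals c l.
pose p := overlap_cell_prob L 1; pose q := M%:R * overlap_cell_prob L M%:R^-1.
rewrite (_ : 'E_P[fun w => #|overlapping_pairs (I w)|%:R] =
   (#|[set u : 'I_n * 'I_n | (u.1 < u.2)%N]%SET|%:R * p)%:E)%E; last first.
  apply: (expectation_card_pairs (r := fun w i j => overlap (I w i) (I w j))).
  - by move=> w i j; exact: overlapC.
  - exact: measurable_overlap_event.
  - exact: probability_overlap.
rewrite (_ : 'E_P[fun w => #|cut_pairs k L (I w)|%:R] =
   (#|[set u : 'I_n * 'I_n | (u.1 < u.2)%N]%SET|%:R * (p - q))%:E)%E; last first.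
  have cutE i j : [set w | overlap (I w i) (I w j) &&
      (interval_color k L (I w i) != interval_color k L (I w j))] =
      overlap_event c l i j `\` same_color_event L c l k i j.
    apply/seteqP; split => w /=; first by case/andP => ? /eqP.
    by case=> ? /eqP ?; apply/andP.
  apply: (expectation_card_pairs (r := fun w i j => overlap (I w i) (I w j) &&
    (interval_color k L (I w i) != interval_color k L (I w j)))).
  - by move=> w i j; rewrite overlapC eq_sym.
  - move=> i j; rewrite cutE; apply: measurableD.
      exact: measurable_overlap_event.
    exact: measurable_same_color_event.
  - by move=> i j ij; rewrite cutE; exact: probability_overlap_cut.
have M0 : 0 < M%:R :> R by rewrite ltr0n.
have pE : p = L * (8 - 3 * L) / 12.
  by rewrite /p overlap_cell_prob1 ?ltW//; field.
have qE : q = L * (4 / (3 * (k%:R - 1) ^+ 2) - 1 / (k%:R - 1) ^+ 3).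
  have k1 : 2 <= k%:R - 1 :> R by lra.
  have eE : M%:R^-1 = L / (k%:R - 1) by rewrite -cellsE; field; lra.
  rewrite /q overlap_cell_prob_small//.
  - by rewrite eE -cellsE; field; lra.
  (* A cell has length L / (k - 1), at most L / 2 because k >= 3. *)
  - by rewrite eE mulrA ler_pdivrMr; nra.
have p0 : 0 < p by rewrite pE divr_gt0// mulr_gt0//; lra.
have C0 : 0 < #|[set u : 'I_n * 'I_n | (u.1 < u.2)%N]%SET|%:R :> R.
  rewrite ltr0n card_gt0; apply/set0Pn.
  (* The pair (0, 1), available since n >= 2. *)
  by exists (Ordinal (ltnW n2), Ordinal n2); rewrite inE.
(* The extended inverse is the real one only away from 0, hence the need for [C0] and [p0]. *)
rewrite inver gt_eqF ?mulr_gt0// -EFinM; congr EFin.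
rewrite -mulf_div divff ?gt_eqF// mul1r mulrBl divff ?gt_eqF//.
rewrite pE qE; field; lra.
Qed.
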